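(* Let $a,b$ be integers and $G\in\mathscr{G}(a,b)$. Then $\delta(G)=\delta^*(G)$ if and only if $a=0$, where $$\delta^*(G)=\frac{a^2-a\delta(G)+b+\delta(G)-\sqrt{(a^2-a\delta(G)+b+\delta(G))^2+4(a-\delta(G))b}}{2}.$$ Equivalently, $\{G\in\mathscr{G}(a,b)\mid \delta(G)=\delta^*(G)\}=\mathscr{G}(0,b)$.
   Context: Graphs are finite, simple and undirected; eigenvalues are those of the adjacency matrix. An eigenvalue of $G$ is main if it has an eigenvector with nonzero entry sum. For integers $a,b$, $\mathscr{G}(a,b)$ is the set of connected graphs with exactly two main eigenvalues satisfying $\sum_{u\in N(v)}d(u)=a\,d(v)+b$ for every vertex $v$. $\delta(G)$ is the minimum degree.
   Formalization: For a fixed nonzero a the set equality fails (for a=1, b=2 the path on three vertices is in G(0,2) but not in G(1,2)); it is stated with b fixed and a ranging over all integers on the left-hand side. The first sentence is unchanged. *)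

(* Defs.v *)
From HB Require Import structures.
From mathcomp Require Import all_boot all_order all_algebra.

Set Implicit Arguments.
Unset Strict Implicit.
Unset Printing Implicit Defensive.

Import Order.TTheory GRing.Theory Num.Theory.
Local Open Scope ring_scope.

Record sgraph := SGraph {
  vertex :> finType;
  adj : rel vertex;
  adj_sym : symmetric adj;
  adj_irrefl : irreflexive adj
}.

Definition neighbours (G : sgraph) (v : G) : {set G} := [set u | adj v u].

Definition degree (G : sgraph) (v : G) : nat := #|neighbours v|.

(* The default value #|G| exceeds every degree, so it never affects the
   minimum of a graph with at least one vertex. *)
Definition min_degree (G : sgraph) : nat :=
  \big[minn/#|G|]_(v : G) degree v.

Definition connected (G : sgraph) : Prop :=
  forall x y : G, connect (@adj G) x y.

Definition adj_mx (R : rcfType) (G : sgraph) : 'M[R]_#|G| :=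
  \matrix_(i, j) (adj (enum_val i) (enum_val j))%:R.

(* Eigenvectors are row vectors, as in [eigenspace]; the matrix is symmetric. *)
Definition main_eigenvalue (R : rcfType) (G : sgraph) (l : R) : Prop :=
  exists v : 'rV[R]_#|G|,
    [/\ v != 0, (v <= eigenspace (adj_mx R G) l)%MS & \sum_i v 0 i != 0].

Definition two_main_eigenvalues (R : rcfType) (G : sgraph) : Prop :=
  exists l1 l2 : R, l1 != l2 /\
    forall l : R, main_eigenvalue G l <-> l = l1 \/ l = l2.

(* The class G(a, b). The empty graph is excluded, since it has no main
   eigenvalue. *)
Definition graph_class (R : rcfType) (a b : int) (G : sgraph) : Prop :=
  [/\ connected G,
      two_main_eigenvalues R G &
      forall v : G,
        \sum_(u in neighbours v) (degree u)%:Z = a * (degree v)%:Z + b].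

(* The radicand is nonnegative whenever [graph_class R a b G] holds, so the
   convention that [Num.sqrt] is 0 on negative numbers plays no role there. *)
Definition delta_star (R : rcfType) (a b : int) (G : sgraph) : R :=
  let a' := a%:~R in
  let b' := b%:~R in
  let d := (min_degree G)%:R in
  let s := a' ^+ 2 - a' * d + b' + d in
  (s - Num.sqrt (s ^+ 2 + 4 * (a' - d) * b')) / 2.

(* Main.v *)
(** The number d = δ(G) satisfies d = δ* only if it is a root of the quadratic
    x² - s x - (a - d) b with s = a² - a d + b + d, whose value at d factors as
    a (d² - a d - b). At a vertex of degree d the neighbour degrees sum to
    a d + b >= d², with equality only if all neighbours have degree d as well.
    Hence d² = a d + b would make the connected graph G regular, and a regular
    graph has only one main eigenvalue. Conversely, for a = 0 the number δ* is
    min(b, d), and b >= d² >= d. *)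
Require Import Defs.
From HB Require Import structures.
From mathcomp Require Import all_boot all_order all_algebra.
From mathcomp Require Import zify ring lra.

Set Implicit Arguments.
Unset Strict Implicit.
Unset Printing Implicit Defensive.

Import Order.TTheory GRing.Theory Num.Theory.
Local Open Scope ring_scope.

Lemma min_degree_le (G : sgraph) (v : G) : (min_degree G <= degree v)%N.
Proof. by rewrite -leEnat; apply: bigmin_le_cond. Qed.

Lemma min_degree_attained (G : sgraph) (x : G) :
  exists v : G, degree v = min_degree G.
Proof.
exists [arg min_(v < x) degree v]%O; apply/esym/(@bigmin_eq_arg _ nat) => // v _.
by rewrite leEnat max_card.
Qed.

Lemma two_main_eigenvalues_inhabited (R : rcfType) (G : sgraph) :
  two_main_eigenvalues R G -> inhabited G.
Proof.
case=> l1 [l2 [_ mainE]]; have /mainE [v [/rV0Pn[i _] _ _]] : l1 = l1 \/ l1 = l2 by left.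
by constructor; exact: (enum_val i).
Qed.

Lemma row_sum_adj_mx (R : rcfType) (G : sgraph) (i : 'I_#|G|) :
  \sum_j adj_mx R G i j = (degree (enum_val i))%:R.
Proof.
under eq_bigr do rewrite mxE.
rewrite -(big_enum_val (fun u => (adj (enum_val i) u)%:R)) /=.
rewrite -natr_sum /degree -sum1_card big_mkcond [in RHS]big_mkcond /=.
by congr _%:R; apply: eq_bigr => u _; rewrite inE; case: adj.
Qed.

(** Summing the entries of [v *m A = l *: v] weights each [v 0 j] by a row sum of [A], that is by
    [k]. So [l] and [k] agree after multiplication by the entry sum of [v], which is nonzero and
    cancels. *)
Lemma regular_main_eigenvalue (R : rcfType) (G : sgraph) (k : nat) (l : R) :
  (forall v : G, degree v = k) -> main_eigenvalue G l -> l = k%:R.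
Proof.
move=> reg [v [_ /eigenspaceP vA sum_v]]; apply: (mulIf sum_v).
rewrite [LHS]mulr_sumr; under eq_bigr => j _.
  by have /matrixP/(_ 0 j) := vA; rewrite !mxE => <-; over.
rewrite exchange_big mulr_sumr; apply: eq_bigr => j _ /=.
by rewrite -mulr_sumr row_sum_adj_mx reg mulrC.
Qed.

Lemma two_main_eigenvalues_irregular (R : rcfType) (G : sgraph) (k : nat) :
  two_main_eigenvalues R G -> ~ (forall v : G, degree v = k).
Proof.
case=> l1 [l2 [/eqP l12 mainE]] reg; apply: l12.
rewrite (regular_main_eigenvalue reg (proj2 (mainE l1) (or_introl erefl))).
by rewrite (regular_main_eigenvalue reg (proj2 (mainE l2) (or_intror erefl))).
Qed.

(** The vertices of degree [k] form a set closed under adjacency, and connectedness carries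
    membership from [x] to every vertex. *)
Lemma connected_regular (G : sgraph) (x : G) (k : nat) :
  connected G -> degree x = k ->
  (forall u v : G, adj u v -> degree u = k -> degree v = k) ->
  forall v : G, degree v = k.
Proof.
move=> conG degx step v; apply/eqP.
have clos : closed (@adj G) [pred u | degree u == k].
  apply: intro_closed; first exact/sym_connect_sym/adj_sym.
  by move=> u w uw /eqP du; apply/eqP/(step u).
by have := closed_connect clos (conG x v); rewrite !inE degx eqxx.
Qed.

Lemma neighbour_degree_sum_ge (G : sgraph) (v : G) :
  (degree v * min_degree G <= \sum_(u in neighbours v) degree u)%N.
Proof.
by rewrite -sum_nat_const; apply: leq_sum => u _; apply: min_degree_le.
Qed.

(** Every summand is at least the minimum degree, so equality of the sums forces equality in each
    term. *)
Lemma neighbour_degree_sum_min (G : sgraph) (v : G) :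
  (\sum_(u in neighbours v) degree u)%N = (degree v * min_degree G)%N ->
  forall u, adj v u -> degree u = min_degree G.
Proof.
rewrite -sum_nat_const => /eqP; rewrite eq_sym.
rewrite (leqif_sum (fun u _ => leqif_eq (min_degree_le u))).
by move=> /forall_inP eq_min u vu; apply/esym/eqP/eq_min; rewrite inE.
Qed.

Section GraphClass.
Variables (R : rcfType) (a b : int) (G : sgraph).
Hypothesis classG : graph_class R a b G.
Local Notation d := (min_degree G).

Lemma graph_class_sum (v : G) :
  ((\sum_(u in neighbours v) degree u)%N%:Z = a * (degree v)%:Z + b).
Proof.
by case: classG => _ _ <-; rewrite -natz natr_sum; under eq_bigr do rewrite natz.
Qed.

Lemma graph_class_min_degree_lt : d%:Z ^+ 2 < a * d%:Z + b.
Proof.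
have [conG twoG _] := classG; have [x] := two_main_eigenvalues_inhabited twoG.
have [v degv] := min_degree_attained x.
rewrite lt_neqAle; apply/andP; split; last first.
  by have := neighbour_degree_sum_ge v; have := graph_class_sum v; rewrite degv; nia.
apply/eqP => d2; apply: (two_main_eigenvalues_irregular twoG (k := d)).
apply: (connected_regular conG degv) => u w uw degu.
apply: neighbour_degree_sum_min uw.
by have := graph_class_sum u; rewrite degu; lia.
Qed.

(** Needed because [Num.sqrt] squares back to its argument only when that argument is
    nonnegative. *)
Lemma delta_star_radicand_ge0 :
  0 <= (a ^+ 2 - a * d%:Z + b + d%:Z) ^+ 2 + 4 * (a - d%:Z) * b.
Proof.
have := graph_class_min_degree_lt; have : 0 <= d%:Z by [].
move: d%:Z => x x0 ltx.
have [a0|a0] := leP 0 a.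
  (* A discriminant equals (s - 2x)² - 4 p(x) for the monic quadratic p, and here p(x) = a (x² - a x
     - b). *)
  have -> : (a ^+ 2 - a * x + b + x) ^+ 2 + 4 * (a - x) * b =
    (a ^+ 2 - a * x + b - x) ^+ 2 + 4 * (a * (a * x + b - x ^+ 2)) by ring.
  by rewrite addr_ge0 ?sqr_ge0// !mulr_ge0 // subr_ge0 ltW.
(* With m = x - a and c = a² - a x + x >= m, the radicand is
   (b + c)² - 4 m b >= (b + m)² - 4 m b = (b - m)². *)
have b0 : 0 <= b by nia.
(* The difference is a (a + 1 - x). Integrality matters: a < 0 gives a + 1 <= 0, so both factors are
   nonpositive. *)
have cm : 0 <= (a ^+ 2 - a * x + x) - (x - a) by nia.
have -> : (a ^+ 2 - a * x + b + x) ^+ 2 + 4 * (a - x) * b =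
    (b - (x - a)) ^+ 2 + ((a ^+ 2 - a * x + x) - (x - a)) *
      (2 * b + (a ^+ 2 - a * x + x) + (x - a)) by ring.
by rewrite addr_ge0 ?sqr_ge0 // mulr_ge0 //; nia.
Qed.

Lemma min_degree_eq_delta_star : d%:R = delta_star R a b G <-> a = 0.
Proof.
have lt_d := graph_class_min_degree_lt; have := delta_star_radicand_ge0.
rewrite /delta_star /= -(ler0z R).
rewrite !(rmorph_nat, rmorphD, rmorphN, rmorphM, rmorphXn) /= -pmulrn => rad_ge0.
split=> [eq_d | a0].
  have /eqP: a * (a * d%:Z + b - d%:Z ^+ 2) = 0.
    apply/eqP; rewrite -(intr_eq0 R) !(rmorph_nat, rmorphD, rmorphN, rmorphM, rmorphXn) /= -pmulrn.
    apply/eqP; move: (sqr_sqrtr rad_ge0) eq_d; set q := Num.sqrt _.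
    move: d%:R a%:~R b%:~R => x y z q2 eq_x.
    (* Solving d = (s - q) / 2 for the root avoids expanding it; squaring then leaves four times the
       claimed identity, up to sign. *)
    have qE : q = y ^+ 2 - y * x + z + x - 2 * x by lra.
    by move: q2; rewrite qE => q2; lra.
  by rewrite mulf_eq0 subr_eq0 (gt_eqF lt_d) orbF => /eqP.
have le_d : (d%:R : R) <= b%:~R.
  by rewrite pmulrn ler_int; move: lt_d; rewrite a0 mul0r add0r; nia.
rewrite a0 mulr0z; move: le_d; move: d%:R b%:~R => x z le_xz.
(* For a = 0 the radicand is (z + x)² - 4 x z, and [le_xz] selects z - x as its root. *)
rewrite [X in Num.sqrt X](_ : _ = (z - x) ^+ 2); last by ring.
by rewrite sqrtr_sqr ger0_norm ?subr_ge0 //; field.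
Qed.

End GraphClass.

Theorem theorem3p5 (R : rcfType) :
  (forall (a b : int) (G : sgraph), graph_class R a b G ->
     ((min_degree G)%:R = delta_star R a b G <-> a = 0))
  /\
  (forall (b : int) (G : sgraph),
     (exists a : int, graph_class R a b G /\
        (min_degree G)%:R = delta_star R a b G)
     <-> graph_class R 0 b G).
Proof.
split=> [a b G | b G]; first exact: min_degree_eq_delta_star.
split=> [[a [classG /(min_degree_eq_delta_star classG) a0]] | classG].
  by rewrite -a0.
by exists 0; split=> //; apply/(min_degree_eq_delta_star classG).
Qed.
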